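(* Let $\mathcal{G}=([n],\mathcal{E})$ be a strongly connected directed graph, and let $\rho$ be the spectral radius of its adjacency matrix $A$. Suppose that the agents' beliefs $\mu_{i,t}(\cdot)$, $i\in[n]$, $t\in\mathbb{N}_0$, evolve according to the memoryless belief updates, i.e. for all $\hat\theta\in\Theta$ and $i\in[n]$ $$\mu_{i,0}(\hat\theta)=\frac{\nu_i(\hat\theta)\,\ell_i(\mathbf{s}_{i,0}\mid\hat\theta)}{\sum_{\tilde\theta\in\Theta}\nu_i(\tilde\theta)\,\ell_i(\mathbf{s}_{i,0}\mid\tilde\theta)},\qquad \mu_{i,t}(\hat\theta)=\frac{\nu_i(\hat\theta)\,\ell_i(\mathbf{s}_{i,t}\mid\hat\theta)\prod_{j\in\mathcal{N}(i)}\frac{\mu_{j,t-1}(\hat\theta)}{\nu_j(\hat\theta)}}{\sum_{\tilde\theta\in\Theta}\nu_i(\tilde\theta)\,\ell_i(\mathbf{s}_{i,t}\mid\tilde\theta)\prod_{j\in\mathcal{N}(i)}\frac{\mu_{j,t-1}(\tilde\theta)}{\nu_j(\tilde\theta)}},\quad t\ge 1.$$ Then no agent can learn the truth unless $\rho=1$; that is, if $\rho\neq 1$, then for every agent $i\in[n]$ it is not the case that $\lim_{t\to\infty}\mu_{i,t}(\theta)=1$ holds $\mathbb{P}_\theta$-almost surely.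
   Context: There are $n$ agents labeled by $[n]=\{1,\dots,n\}$. The neighborhood of agent $i$ is $\mathcal{N}(i)=\{j\in[n]:(j,i)\in\mathcal{E}\}$, and the adjacency matrix $A$ is the $n\times n$ matrix with $[A]_{ij}=1$ if $(j,i)\in\mathcal{E}$ and $[A]_{ij}=0$ otherwise. $\mathcal{G}$ is strongly connected if there is a directed path from any agent to any other agent. $\Theta$ is a finite set of states of the world with at least two elements, and $\theta\in\Theta$ is a fixed state, the true state. Each agent $i$ has a finite signal space $\mathcal{S}_i$, and for each $\hat\theta\in\Theta$ a probability mass function $\ell_i(\cdot\mid\hat\theta)$ on $\mathcal{S}_i$ (the signal structure) with $\ell_i(s\mid\hat\theta)>0$ for all $s\in\mathcal{S}_i$ and $\hat\theta\in\Theta$ (so that all log-likelihood ratios are finite). Each agent $i$ has a prior $\nu_i$, a probability mass function on $\Theta$ with $\nu_i(\hat\theta)>0$ for all $\hat\theta\in\Theta$. Under the probability measure $\mathbb{P}_\theta$, the private signals $\mathbf{s}_{i,t}$, $i\in[n]$, $t\in\mathbb{N}_0$, are independent, and $\mathbf{s}_{i,t}$ takes values in $\mathcal{S}_i$ with probability mass function $\ell_i(\cdot\mid\theta)$. An agent $i$ is said to learn the truth if $\lim_{t\to\infty}\mu_{i,t}(\theta)=1$, $\mathbb{P}_\theta$-almost surely. *)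

(* Defs.v *)
From mathcomp Require Import all_boot all_order all_algebra.
From mathcomp Require Import all_classical all_reals all_analysis.
From mathcomp Require Import complex.

Set Implicit Arguments.
Unset Strict Implicit.
Unset Printing Implicit Defensive.

Import Order.TTheory GRing.Theory Num.Theory.
Import numFieldNormedType.Exports.

Local Open Scope classical_set_scope.
Local Open Scope ring_scope.

(* A directed graph on the n agents is a relation E on 'I_n: E j i means that
   (j, i) is an edge, that is, agent i observes agent j. Self-loops are
   allowed. *)

Definition neighborhood (n : nat) (E : rel 'I_n) (i : 'I_n) : {set 'I_n} :=
  finset (fun j => E j i).

Definition adjacency (R : pzSemiRingType) (n : nat) (E : rel 'I_n) : 'M[R]_n :=
  \matrix_(i, j) (j \in neighborhood E i)%:R.

Definition strongly_connected (n : nat) (E : rel 'I_n) : Prop :=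
  forall i j : 'I_n, i != j -> connect E i j.

(* The set of moduli is finite, and nonempty as soon as n > 0, so the supremum
   is then a maximum. The norm of z : R[i] is itself a complex number with zero
   imaginary part, hence the projection to R. *)
Definition spectral_radius (R : realType) (n : nat) (A : 'M[R]_n) : R :=
  sup [set complex.Re `|z| | z in
        [set z : R[i] | eigenvalue (map_mx (real_complex R) A) z]].

Definition is_pmf (R : realType) (T : finType) (f : T -> R) : Prop :=
  (forall x, 0 <= f x) /\ \sum_(x : T) f x = 1.

(* Random variables with values in a finite type, which carries the discrete
   sigma-algebra. *)
Definition finite_rv (d : measure_display) (Omega : measurableType d)
    (T : finType) (X : Omega -> T) : Prop :=
  forall B : set T, measurable (X @^-1` B).

Definition mutually_independent (R : realType) (d : measure_display)
    (Omega : measurableType d) (P : probability Omega R) (K : eqType)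
    (T : K -> finType) (X : forall k : K, Omega -> T k) : Prop :=
  forall (J : seq K) (B : forall k : K, set (T k)), uniq J ->
    P (\bigcap_(k in [set` J]) (X k @^-1` B k)) =
    (\prod_(k <- J) P (X k @^-1` B k))%E.

Section Beliefs.
Variables (R : realType) (n : nat) (Theta : finType) (S : 'I_n -> finType).
(* [l i th s] is the likelihood of the signal s in the state th. *)
Variables (E : rel 'I_n) (l : forall i : 'I_n, Theta -> S i -> R).
Variables (nu : 'I_n -> Theta -> R) (Omega : Type).
Variables (s : forall i : 'I_n, nat -> Omega -> S i).
Variables (mu : 'I_n -> nat -> Omega -> Theta -> R).

Definition initial_weight (i : 'I_n) (w : Omega) (th : Theta) : R :=
  nu i th * l th (s i 0 w).

Definition update_weight (i : 'I_n) (t : nat) (w : Omega) (th : Theta) : R :=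
  nu i th * l th (s i t w) *
  \prod_(j in neighborhood E i) (mu j t.-1 w th / nu j th).

Definition memoryless_updates : Prop :=
  (forall i w th, mu i 0 w th =
    initial_weight i w th / \sum_(th' : Theta) initial_weight i w th') /\
  (forall i t w th, (1 <= t)%N -> mu i t w th =
    update_weight i t w th / \sum_(th' : Theta) update_weight i t w th').

End Beliefs.

Definition learns_truth (R : realType) (d : measure_display)
    (Omega : measurableType d) (P : probability Omega R) (Theta : finType)
    (theta : Theta) (mu_i : nat -> Omega -> Theta -> R) : Prop :=
  {ae P, forall w, mu_i t w theta @[t --> \oo] --> (1 : R)}.

(* Main.v *)
(* If every agent had exactly one in-neighbour, the row sums of the adjacency
   matrix A would be 1 and its spectral radius would be 1. So either the graph
   is a single vertex without edges, or every agent has an in-neighbour and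
   some agent has at least two. Fix a state th' other than the truth. The
   logarithmic ratio of the beliefs in th' and in the truth, corrected by the
   priors, satisfies x (t+1) = lam (t+1) + A x t, where lam is the
   log-likelihood ratio of the private signals. If lam vanishes, or if there
   is no edge, x is bounded. Otherwise some signal strictly favours th'. With
   positive probability, all agents receive their signals most favourable to
   th' during a long initial period, which makes x large. Branching then makes
   x outgrow the bounded influence of all later signals, so x never becomes
   negative again, and the belief in the truth stays away from 1. *)
Require Import Defs.
From mathcomp Require Import all_boot all_order all_algebra.
From mathcomp Require Import all_classical all_reals all_analysis.
From mathcomp Require Import complex zify ring lra.

Set Implicit Arguments.
Unset Strict Implicit.
Unset Printing Implicit Defensive.

Import Order.TTheory GRing.Theory Num.Theory.
Import numFieldNormedType.Exports.

Local Open Scope classical_set_scope.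
Local Open Scope ring_scope.

(** * Distance from a vertex that reaches all others *)

Section Distance.
Variables (T : finType) (E : rel T).

(** [d i] is the length of a shortest path from [v] to [i]; deleting its last edge leaves a shorter
    path, to an in-neighbour of [i]. *)
Lemma distance_decreasing (v : T) : (forall i, connect E v i) ->
  exists d : T -> nat, forall i, i != v -> exists2 j, E j i & (d j < d i)%N.
Proof.
move=> hv.
pose reach i k := [exists p : k.-tuple T, path E v p && (last v p == i)].
have ex i : exists k, reach i k.
  have /connectP[p hp ->] := hv i.
  by exists (size p); apply/existsP; exists (in_tuple p); rewrite hp eqxx.
exists (fun i => ex_minn (ex i)) => i iv.
case: (ex_minnP (ex i)) => k /existsP[p /andP[]].
have := size_tuple p.
case/lastP: (tval p) => [_ _ /= /eqP vi|p' y]; first by rewrite vi eqxx in iv.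
rewrite size_rcons last_rcons rcons_path => <- /andP[hp' hl] /eqP yi _.
rewrite -{}yi; exists (last v p') => //.
case: ex_minnP => m _ /(_ (size p')); apply.
by apply/existsP; exists (in_tuple p'); rewrite hp' eqxx.
Qed.

End Distance.

(** * Growth and persistence of sign for the linear recursion *)

Section LinearRecursion.
Variables (R : archiRealFieldType) (n : nat) (E : rel 'I_n).

Definition linear_recursion (lam x : 'I_n -> nat -> R) : Prop :=
  (forall i, x i 0%N = lam i 0%N) /\
  (forall i t, x i t.+1 = lam i t.+1 + \sum_(j | E j i) x j t).

Hypothesis hconn : forall i j, connect E i j.
Hypothesis hdeg : forall i, exists j, E j i.

Lemma sum_ge_term (I : finType) (Q : pred I) (F : I -> R) j :
  (forall i, Q i -> 0 <= F i) -> Q j -> F j <= \sum_(i | Q i) F i.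
Proof.
move=> h0 Qj; rewrite (bigD1 j) //= lerDl sumr_ge0 // => k /andP[Qk _].
exact: h0.
Qed.

(* Every N rounds the drift c at v, transported along shortest paths, raises the
   whole vector by c. *)
Lemma linear_recursion_grows (v : 'I_n) (c : R) (q : nat) : 0 <= c ->
  exists T, forall lam x, linear_recursion lam x ->
    (forall j t, (t <= T)%N -> 0 <= lam j t) ->
    (forall t, (t <= T)%N -> c <= lam v t) ->
    forall i, c *+ q <= x i T.
Proof.
move=> c0; have [d hd] := distance_decreasing (hconn v).
pose N := (\max_i d i).+1.
have dN i : (d i < N)%N by rewrite ltnS; apply: leq_bigmax.
(* Each of the [q] rounds takes [N] steps; the last [N] leave room for the distance of any vertex
   from [v]. *)
exists (q * N + N)%N => lam x [x0 xS] lam0 lamv i.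
have x_ge0 t j : (t <= q * N + N)%N -> 0 <= x j t.
  elim: t j => [|t IH] j ht; first by rewrite x0 lam0.
  rewrite xS addr_ge0 ?lam0 // sumr_ge0 // => k _; exact/IH/ltnW.
(* Strengthening for the induction on [t]: the level [c *+ r] reaches [j] with a delay of [d j]. *)
suff inv t j r : (t <= q * N + N)%N -> (r * N + d j <= t)%N ->
    c *+ r <= x j t.
  by apply: inv => //; rewrite leq_add2l ltnW.
elim: t j r => [|t IH] j r ht.
  rewrite leqn0 addn_eq0 muln_eq0 orbF => /andP[/eqP-> _].
  by rewrite mulr0n x_ge0.
have xle k : E k j -> x k t <= \sum_(k | E k j) x k t.
  move=> Ek; apply: (sum_ge_term (F := fun k => x k t)) => // k' _.
  exact/x_ge0/ltnW.
move=> hr; rewrite xS; have [jv|jv] := eqVneq j v.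
(* At [v] the drift adds one [c], and any in-neighbour [k] already has the previous level because
   [d k < N]. *)
- case: r hr => [|r] hr; first by rewrite mulr0n -xS x_ge0.
  have [k Ek] := hdeg j.
  rewrite mulrS lerD ?jv ?lamv // -jv; apply: le_trans (xle k Ek).
  apply: IH; first exact: ltnW.
  by move: hr (dN k); rewrite mulSn; lia.
- have [k Ek dk] := hd j jv.
  rewrite -[leLHS]add0r lerD ?lam0 //; apply: le_trans (xle k Ek).
  apply: IH; first exact: ltnW.
  by rewrite -ltnS; apply: leq_trans hr; rewrite ltn_add2l.
Qed.

(* With d the distance from v, the vector w i = C (2N + 1 - d i) satisfies
   w i + C <= \sum_(j | E j i) w j: a neighbour closer to v suffices when
   i != v, and two arbitrary neighbours do when i = v. *)
Lemma linear_recursion_stays_nonneg (v : 'I_n) (C : R) : 0 <= C ->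
    (1 < #|neighborhood E v|)%N ->
  exists H, 0 <= H /\ forall lam x T, linear_recursion lam x ->
    (forall j t, - C <= lam j t) -> (forall i, H <= x i T) ->
    forall t i, (T <= t)%N -> 0 <= x i t.
Proof.
move=> C0 /card_gt1P[a [b]]; rewrite !inE => -[Ea Eb ab].
have [d hd] := distance_decreasing (hconn v).
pose N := \max_i d i.
have dN i : (d i)%:R <= N%:R :> R by rewrite ler_nat; apply: leq_bigmax.
pose w i : R := C * (2 * N%:R + 1 - (d i)%:R).
have N0 : 0 <= N%:R :> R by [].
have w0 i : 0 <= w i by rewrite mulr_ge0 //; move: (dN i); lra.
(* This bounds every [w i] from above, so [w <= x] at time [T]; the recursion then preserves
   [w <= x]. *)
exists (C * (2 * N%:R + 1)); split; first by rewrite mulr_ge0 //; lra.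
move=> lam x T [_ xS] lamC xT t i /subnK <-.
apply: le_trans (w0 i) _.
elim: {t} (t - T)%N i => [|t IH] i.
  by apply: le_trans (xT i); rewrite ler_wpM2l // lerBlDr lerDl.
rewrite addSn xS.
apply: (@le_trans _ _ (- C + \sum_(j | E j i) w j)); last first.
  by rewrite lerD // ler_sum.
have [->|iv] := eqVneq i v.
- rewrite (bigD1 a) //= (bigD1 b) ?Eb 1?eq_sym //=.
  apply: (@le_trans _ _ (- C + (w a + w b))).
    have hC : 0 <= C * (2 * N%:R - (d a)%:R - (d b)%:R + (d v)%:R).
      rewrite mulr_ge0 //; have := dN a; have := dN b.
      have : 0 <= (d v)%:R :> R by []. lra.
    by rewrite /w; lra.
  by rewrite lerD2l addrA lerDl sumr_ge0.
- have [j Ej dj] := hd i iv.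
  apply: (@le_trans _ _ (- C + w j)); last by rewrite lerD2l sum_ge_term.
  have hC : 0 <= C * ((d i)%:R - (d j)%:R - 1).
    by rewrite mulr_ge0 // subr_ge0 lerBrDr addrC natr1 ler_nat.
  by rewrite /w; lra.
Qed.

(** The drift at [v'] lifts [x] to the level [H], from which the branching at [v] compensates all
    later losses of at most [C]. By the archimedean property, [Num.bound (H / c)] rounds suffice. *)
Lemma linear_recursion_ge0 (v v' : 'I_n) (c C : R) : 0 < c -> 0 <= C ->
    (1 < #|neighborhood E v|)%N ->
  exists T, forall lam x, linear_recursion lam x ->
    (forall j t, - C <= lam j t) ->
    (forall j t, (t <= T)%N -> 0 <= lam j t) ->
    (forall t, (t <= T)%N -> c <= lam v' t) ->
    forall t i, (T <= t)%N -> 0 <= x i t.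
Proof.
move=> c0 C0 hv.
have [H [H0 hH]] := linear_recursion_stays_nonneg C0 hv.
have [T hT] := linear_recursion_grows v' (Num.bound (H / c)) (ltW c0).
exists T => lam x rec lamC lam0 lamv; apply: (hH _ _ _ rec lamC) => i.
apply: le_trans (hT _ _ rec lam0 lamv i).
rewrite -[_ *+ _]mulr_natl -ler_pdivrMr // ltW // archi_boundP //.
by rewrite divr_ge0 // ltW.
Qed.

End LinearRecursion.

(** * Spectral radius when all in-degrees are one *)

Lemma spectral_radius_indegree1 (R : realType) (n : nat) (E : rel 'I_n) :
  (0 < n)%N -> (forall i, #|neighborhood E i| = 1%N) ->
  spectral_radius (adjacency R E) = 1.
Proof.
move=> n0 hdeg; rewrite /spectral_radius.
set A := map_mx _ _.
have AE i j : A i j = (j \in neighborhood E i)%:R by rewrite !mxE rmorph_nat.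
have rowA i : \sum_j A i j = 1.
  under eq_bigr do rewrite AE.
  by rewrite -natr_sum -big_mkcond sum1_card hdeg.
(* [eigenvalue] refers to row vectors; as the rows of [A] are nonnegative with sum 1, the l1 norm of
   [v *m A] is at most that of [v]. *)
have norm_le1 z : eigenvalue A z -> `|z| <= 1.
  move=> /eigenvalueP[v vA v0].
  have vpos : 0 < \sum_j `|v 0 j|.
    have [j vj] : exists j, v 0 j != 0.
      by apply/existsP; apply: contra_neqT v0 => /existsPn v0;
         apply/rowP => j; rewrite mxE; apply/eqP/negPn/v0.
    rewrite (bigD1 j) //= ltr_pwDl ?normr_gt0 // sumr_ge0 //.
  rewrite -(ler_pM2r vpos) mul1r mulr_sumr.
  apply: (@le_trans _ _ (\sum_j \sum_i `|v 0 i| * A i j)).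
    apply: ler_sum => j _; rewrite -normrM.
    have -> : z * v 0 j = (v *m A) 0 j by rewrite vA mxE.
    rewrite mxE; apply: le_trans (ler_norm_sum _ _ _) _.
    by apply: ler_sum => i _; rewrite normrM AE normr_nat.
  rewrite exchange_big /=; apply: ler_sum => i _.
  by rewrite -mulr_sumr rowA mulr1.
(* [A - 1%:M] annihilates the all-ones column, so it is singular and has a nonzero row kernel as
   well. *)
have eig1 : eigenvalue A 1.
  rewrite /eigenvalue /eigenspace kermx_eq0 row_free_unit.
  apply/negP => uA.
  have : (A - 1%:M) *m const_mx 1 = 0 :> 'cV_n.
    rewrite mulmxBl mul1mx; apply/colP => i; rewrite !mxE.
    under eq_bigr do rewrite [const_mx _ _ _]mxE mulr1.
    by rewrite rowA subrr.
  move=> /(congr1 (mulmx (invmx (A - 1%:M)))); rewrite mulKmx // mulmx0.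
  move=> /colP/(_ (Ordinal n0)); rewrite !mxE => /eqP.
  by rewrite oner_eq0.
have le1 z : eigenvalue A z -> complex.Re `|z| <= 1.
  by move=> /norm_le1; rewrite lecE => /andP[].
apply/eqP; rewrite eq_le; apply/andP; split.
  apply: ge_sup; first by exists 1; exists 1 => //; rewrite normr1.
  by move=> _ [z hz <-]; exact: le1.
apply: ub_le_sup; last by exists 1 => //; rewrite normr1.
by exists 1 => _ [z hz <-]; exact: le1.
Qed.

(** * Signal laws, logarithms and cylinder events *)

Lemma pmf_eq_or_lt (R : realType) (T : finType) (f g : T -> R) :
  is_pmf f -> is_pmf g -> (exists x, g x < f x) \/ (forall x, f x = g x).
Proof.
move=> [_ f1] [_ g1].
have [/existsP|/existsPn h] := boolP [exists x, g x < f x]; first by left.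
(* Otherwise [g - f] is nonnegative with sum 0, hence vanishes. *)
have le x : 0 <= g x - f x by rewrite subr_ge0 leNgt h.
right => x; apply/eqP; rewrite eq_sym -subr_eq0.
have /psumr_eq0P -> // : \sum_x (g x - f x) = 0 by rewrite sumrB f1 g1 subrr.
Qed.

Lemma ln_prodr (R : realType) (I : finType) (Q : pred I) (F : I -> R) :
  (forall i, Q i -> 0 < F i) ->
  ln (\prod_(i | Q i) F i) = \sum_(i | Q i) ln (F i).
Proof.
move=> F0; suff [] : 0 < \prod_(i | Q i) F i /\
    ln (\prod_(i | Q i) F i) = \sum_(i | Q i) ln (F i) by [].
elim/big_rec2: _ => [|i y x /F0 Fi [x0 <-]]; first by rewrite ln1.
by rewrite mulr_gt0 // lnM.
Qed.

(** Only finitely many pairs of agent and time are constrained, so independence gives a finite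
    product of positive factors. *)
Lemma cylinder_probability_gt0 (R : realType) (d : measure_display)
    (Omega : measurableType d) (P : probability Omega R) (n : nat)
    (S : 'I_n -> finType) (s : forall i : 'I_n, nat -> Omega -> S i)
    (f : forall i, S i) (T : nat) :
  (forall i t, finite_rv (s i t)) ->
  mutually_independent P (fun k : 'I_n * nat => s k.1 k.2) ->
  (forall i t, (0 < P (s i t @^-1` [set f i]))%E) ->
  exists F : set Omega, [/\ measurable F, (0 < P F)%E &
    forall w, F w -> forall i t, (t <= T)%N -> s i t w = f i].
Proof.
move=> hrv hind hpos.
pose J := [seq (i, t) | i <- enum 'I_n, t <- iota 0 T.+1].
exists (\bigcap_(k in [set` J]) (s k.1 k.2 @^-1` [set f k.1])); split.
- apply: fin_bigcap_measurable => [|k _]; last exact: hrv.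
  exact: finite_seq.
- rewrite (hind J (fun k => [set f k.1])); last first.
    by apply: allpairs_uniq; rewrite ?enum_uniq ?iota_uniq // => -[? ?] [? ?].
  elim/big_rec: _ => [|k y _ y0]; first exact: lte01.
  by rewrite mule_gt0.
- move=> w Fw i t tT; apply: (Fw (i, t)) => /=.
  by apply: allpairs_f; rewrite ?mem_enum // mem_iota.
Qed.

(** * From belief updates to the linear recursion *)

Section LogBeliefs.
Variables (R : realType) (n : nat) (E : rel 'I_n) (Theta : finType).
Variables (S : 'I_n -> finType) (l : forall i : 'I_n, Theta -> S i -> R).
Variables (nu : 'I_n -> Theta -> R) (Omega : Type).
Variables (s : forall i : 'I_n, nat -> Omega -> S i).
Variables (mu : 'I_n -> nat -> Omega -> Theta -> R).
Hypothesis hl_pos : forall (i : 'I_n) (th : Theta) (x : S i), 0 < l th x.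
Hypothesis hnu_pos : forall (i : 'I_n) (th : Theta), 0 < nu i th.
Hypothesis hmu : memoryless_updates E l nu s mu.

Lemma normalized_pmf (W : Theta -> R) (th0 : Theta) : (forall th, 0 < W th) ->
  0 < \sum_th' W th' /\ \sum_th (W th / \sum_th' W th') = 1.
Proof.
move=> W0; have S0 : 0 < \sum_th' W th'.
  by rewrite (bigD1 th0) //= ltr_pwDl // sumr_ge0 // => *; exact: ltW.
by split=> //; rewrite -mulr_suml divff // gt_eqF.
Qed.

Lemma update_weight_gt0 i t w th :
  (forall j, 0 < mu j t w th) -> 0 < update_weight E l nu s mu i t.+1 w th.
Proof.
move=> mu0; rewrite /update_weight !mulr_gt0 //.
by apply: prodr_gt0 => j _; rewrite divr_gt0.
Qed.

Lemma belief_gt0 i t w th : 0 < mu i t w th.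
Proof.
case: hmu => mu_0 mu_S; elim: t i th => [|t IH] i th.
  rewrite mu_0; have w0 th' : 0 < initial_weight l nu s i w th' by rewrite mulr_gt0.
  by rewrite divr_gt0 //; case: (normalized_pmf th w0).
rewrite mu_S //; have w0 th' := update_weight_gt0 i (fun j => IH j th').
by rewrite divr_gt0 //; case: (normalized_pmf th w0).
Qed.

Lemma belief_sum1 i t w (th0 : Theta) : \sum_th mu i t w th = 1.
Proof.
case: hmu => mu_0 mu_S; case: t => [|t].
  under eq_bigr do rewrite mu_0.
  by apply: (normalized_pmf th0 _).2 => th; rewrite mulr_gt0.
under eq_bigr do rewrite mu_S //.
apply: (normalized_pmf th0 _).2 => th.
by apply: update_weight_gt0 => j; apply: belief_gt0.
Qed.

(** Dividing by the priors matches the factors of the update rule, so no prior term remains in the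
    recursion. *)
Definition log_belief_ratio (th' th : Theta) w i t : R :=
  ln (mu i t w th' / nu i th') - ln (mu i t w th / nu i th).

Definition log_likelihood_ratio (th' th : Theta) i (x : S i) : R :=
  ln (l th' x) - ln (l th x).

(** The normalizing constant is common to both states and cancels in the difference; the logarithm
    turns the product over neighbours into a sum. *)
Lemma log_belief_ratio_recursion th' th w :
  linear_recursion E (fun i t => log_likelihood_ratio th' th (s i t w))
    (log_belief_ratio th' th w).
Proof.
case: hmu => mu_0 mu_S.
have lnW a b c : 0 < a -> 0 < b -> 0 < c -> ln (a * b / c / a) = ln b - ln c :> R.
  move=> a0 b0 c0; rewrite -ln_div ?posrE //; congr ln.
  by field; rewrite !gt_eqF.
split=> [i|i t]; rewrite /log_belief_ratio /log_likelihood_ratio.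
  rewrite !mu_0; set Z := \sum_(_ : _) _.
  have Z0 : 0 < Z by apply: (normalized_pmf th _).1 => *; rewrite mulr_gt0.
  by rewrite !lnW //; ring.
rewrite !mu_S //; set Z := \sum_(_ : _) _.
have Z0 : 0 < Z.
  apply: (normalized_pmf th _).1 => *.
  by apply: update_weight_gt0 => *; apply: belief_gt0.
have r0 j th0 : 0 < mu j t w th0 / nu j th0 by rewrite divr_gt0 // belief_gt0.
have p0 th0 : 0 < \prod_(j in neighborhood E i) (mu j t w th0 / nu j th0).
  by apply: prodr_gt0.
have nE : (fun j => j \in neighborhood E i) =1 (fun j => E j i).
  by move=> j; rewrite inE.
have WE th0 : update_weight E l nu s mu i t.+1 w th0 = nu i th0 *
    (l th0 (s i t.+1 w) * \prod_(j in neighborhood E i) (mu j t w th0 / nu j th0)).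
  by rewrite /update_weight mulrA.
rewrite !WE !lnW ?mulr_gt0 //.
rewrite !lnM ?posrE //= !ln_prodr //= !(eq_bigl _ _ nE) sumrB; ring.
Qed.

End LogBeliefs.

(** [f] and [T] prescribe a finite prefix of signals, later to be an event of positive probability;
    all signals after [T] are arbitrary. *)
Lemma recursion_bounded_below (R : realType) (n : nat) (E : rel 'I_n)
    (S : 'I_n -> finType) (x0 : forall i, S i)
    (lam : forall i, S i -> R) :
  (forall i j, connect E i j) ->
  ~ (forall i, #|neighborhood E i| = 1%N) ->
  (forall i, (exists x, 0 < lam i x) \/ (forall x, lam i x = 0)) ->
  exists (f : forall i, S i) (T : nat) (B : R),
    forall (s : forall i : 'I_n, nat -> S i) (x : 'I_n -> nat -> R),
      linear_recursion E (fun i t => lam i (s i t)) x ->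
      (forall i t, (t <= T)%N -> s i t = f i) ->
      forall i t, (T <= t)%N -> B <= x i t.
Proof.
move=> hconn hdeg hlam.
pose C := \sum_i \sum_y `|lam i y|.
have C0 : 0 <= C by do 2! (apply: sumr_ge0 => ? _).
have lamC i y : - C <= lam i y.
  apply: lerNnormlW; apply: (@le_trans _ _ (\sum_y `|lam i y|)).
    by apply: (sum_ge_term (F := fun y => `|lam i y|)).
  apply: (sum_ge_term (F := fun i => \sum_y `|lam i y|)) => // *.
  exact: sumr_ge0.
(* If [lam] vanishes, [x] is identically 0 and any prefix will do. *)
have [lam_eq0|/existsNP[v hv]] := pselect (forall i y, lam i y = 0).
  exists x0, 0%N, 0 => s x [x_0 x_S] _ i t _; rewrite le_eqVlt; apply/orP; left.
  apply/eqP/esym; elim: t i => [|t IH] i; first by rewrite x_0 lam_eq0.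
  by rewrite x_S lam_eq0 add0r big1.
have {hv} [y hy] : exists y, 0 < lam v y by case: (hlam v).
(* A vertex without in-neighbours is the only vertex, since a path from elsewhere would have to
   enter it; then [x] equals [lam]. *)
have [/existsP[i0 /eqP hi0]|/existsPn hdeg0] :=
    boolP [exists i, #|neighborhood E i| == 0%N].
  have noE j : E j i0 = false.
    by have := card0_eq hi0 j; rewrite inE.
  have only i : i = i0.
    have /connectP[p] := hconn i i0.
    case/lastP: p => [|p z] //; rewrite rcons_path last_rcons => /andP[_ +] z0.
    by rewrite -z0 noE.
  exists x0, 0%N, (- C) => s x [x_0 x_S] _ i [|t] _; first by rewrite x_0.
  by rewrite x_S big1 ?addr0 // => j; rewrite (only i) noE.
have hdeg1 i : exists j, E j i.
  have : (0 < #|neighborhood E i|)%N by rewrite lt0n hdeg0.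
  by case/card_gt0P => j; rewrite inE; exists j.
have [u hu] : exists u, (1 < #|neighborhood E u|)%N.
  move/existsNP: hdeg => [u hu]; exists u; rewrite ltn_neqAle lt0n hdeg0 andbT.
  by rewrite eq_sym; apply/eqP.
(* The maximum of [lam] is nonnegative for every agent and positive for [v]. *)
pose f i : S i := [arg max_(y > x0 i) lam i y]%O.
have fmax i y' : lam i y' <= lam i (f i).
  by rewrite /f; case: arg_maxP => // m _ ; exact.
have f0 i : 0 <= lam i (f i).
  case: (hlam i) => [[y' hy']|->] //; exact: le_trans (ltW hy') (fmax _ _).
have fv : 0 < lam v (f v) by exact: lt_le_trans hy (fmax _ _).
have [T hT] := linear_recursion_ge0 hconn hdeg1 v fv C0 hu.
exists f, T, 0 => s x rec hs i t tT.
apply: (hT _ _ rec) => // [j t' t'T|t' t'T]; by rewrite hs.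
Qed.

Theorem theorem1 (R : realType) (n : nat) (E : rel 'I_n)
    (hE : strongly_connected E)
    (Theta : finType) (hTheta : (2 <= #|Theta|)%N) (theta : Theta)
    (S : 'I_n -> finType)
    (l : forall i : 'I_n, Theta -> S i -> R)
    (hl : forall (i : 'I_n) (th : Theta), is_pmf (l i th))
    (hl_pos : forall (i : 'I_n) (th : Theta) (x : S i), 0 < l i th x)
    (nu : 'I_n -> Theta -> R)
    (hnu : forall i : 'I_n, is_pmf (nu i))
    (hnu_pos : forall (i : 'I_n) (th : Theta), 0 < nu i th)
    (d : measure_display) (Omega : measurableType d)
    (P : probability Omega R)
    (s : forall i : 'I_n, nat -> Omega -> S i)
    (hs_rv : forall (i : 'I_n) (t : nat), finite_rv (s i t))
    (hs_indep : mutually_independent P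
      (fun k : 'I_n * nat => s k.1 k.2))
    (hs_law : forall (i : 'I_n) (t : nat) (x : S i),
      P (s i t @^-1` [set x]) = (l i theta x)%:E)
    (mu : 'I_n -> nat -> Omega -> Theta -> R)
    (hmu : memoryless_updates E l nu s mu) :
  spectral_radius (adjacency R E) <> 1 ->
  forall i : 'I_n, ~ learns_truth P theta (mu i).
Proof.
move=> rho i learns.
have [th' th'E] : exists th', th' != theta.
  have /card_gt1P[a [b [_ _ ab]]] := hTheta.
  by have [at_|] := eqVneq a theta; [exists b; rewrite -at_ eq_sym | exists a].
have hconn a b : connect E a b.
  by have [->|/hE //] := eqVneq a b; exact: connect0.
have hdeg : ~ (forall a, #|neighborhood E a| = 1%N).
  move=> h; apply/rho/spectral_radius_indegree1 => //.
  exact: leq_ltn_trans (leq0n i) (ltn_ord i).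
(* A signal law sums to 1, so no signal space is empty. *)
have x0 a : S a.
  have [//|S0] := pickP (mem (S a)).
  have [_] := hl a theta; rewrite big1; first by move/eqP; rewrite eq_sym oner_eq0.
  by move=> x; have := S0 x.
have hlam a : (exists x : S a, 0 < log_likelihood_ratio l th' theta x :> R) \/
    (forall x : S a, log_likelihood_ratio l th' theta x = 0).
  rewrite /log_likelihood_ratio.
  have [[x lx]|eq] := pmf_eq_or_lt (hl a th') (hl a theta).
    by left; exists x; rewrite subr_gt0 ltr_ln ?posrE.
  by right => x; rewrite eq subrr.
have [f [T [B hB]]] := recursion_bounded_below x0 hconn hdeg hlam.
have hpos a t : (0 < P (s a t @^-1` [set f a]))%E by rewrite hs_law lte_fin.
have [F [mF PF hF]] := cylinder_probability_gt0 T hs_rv hs_indep hpos.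
(* Convergence to 1 fails at every point of [F], so [F] lies in the exceptional null set. *)
have : P F = 0%E.
  apply: measure_negligible => //; apply: negligibleS learns => w Fw /= cvg1.
  (* The lower bound [B] gives [b * q <= p] for the beliefs [p] in [th'] and [q] in [theta]; since
     [p + q <= 1], [q] is at most [(1 + b)^-1]. *)
  pose b := expR B * (nu i th' / nu i theta).
  have b0 : 0 < b by rewrite mulr_gt0 ?expR_gt0 // divr_gt0.
  have mu_gt0 := belief_gt0 hl_pos hnu_pos hmu.
  have mu_le t : (T <= t)%N -> mu i t w theta <= (1 + b)^-1.
    move=> Tt.
    have := hB _ _ (log_belief_ratio_recursion hl_pos hnu_pos hmu th' theta w)
      (hF w Fw) i t Tt.
    rewrite /log_belief_ratio -ln_div ?posrE ?divr_gt0 ?mu_gt0 //.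
    rewrite -ler_expR lnK ?posrE ?divr_gt0 ?mu_gt0 //.
    set p := mu i t w th'; set q := mu i t w theta => Bpq.
    have q0 : 0 < q := mu_gt0 i t w theta.
    have bq : b * q <= p.
      have -> : p = p / nu i th' / (q / nu i theta) * (nu i th' / nu i theta) * q.
        by field; rewrite !gt_eqF.
      by rewrite ler_pM2r // ler_pM2r // divr_gt0.
    rewrite -[leRHS]mul1r ler_pdivlMr ?addr_gt0 // mulrDr mulr1.
    rewrite -(belief_sum1 hl_pos hnu_pos hmu i t w theta).
    rewrite (bigD1 theta) //= (bigD1 th') //=.
    rewrite lerD2l mulrC (le_trans bq) // lerDl sumr_ge0 // => th _.
    exact/ltW/mu_gt0.
  have lt1 : (1 + b)^-1 < 1 by rewrite invf_lt1 ?addr_gt0 // ltrDl.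
  have [t0 _ ht0] := cvgr_gt _ cvg1 _ lt1.
  have := ht0 (maxn t0 T) (leq_maxl _ _).
  by rewrite /= ltNge mu_le // leq_maxr.
by move=> PF0; rewrite PF0 ltxx in PF.
Qed.
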